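(* Under the standing setting and Assumptions (A1), (A2) described in the context, suppose $\bar f(0)=0$ and that for every $\epsilon\in(0,\epsilon_0)$ the equilibrium $0$ of the piecewise constant process $\bar X^{\rm d}(t)$ (continuous-time version of the discrete average system) is exponentially stable, i.e. there are $r_\epsilon,c_\epsilon,\gamma_\epsilon>0$ with $|\bar X^{\rm d}(t)|\le c_\epsilon|x|e^{-\gamma_\epsilon t}$ for all $t\ge 0$ whenever $|x|<r_\epsilon$. Then there exist constants $r_\epsilon>0$, $c_\epsilon>0$, $\gamma_\epsilon>0$ and a function $T:(0,\epsilon_0)\to\mathbb N$ with $\lim_{\epsilon\to0}T(\epsilon)=+\infty$ such that for every initial condition $X_0=\bar X^{\rm d}_0=x$ with $|x|<r_\epsilon$ and every $\delta>0$, $$\lim_{\epsilon\to0}\inf\{t\ge0:|X(t)|>c_\epsilon|x|e^{-\gamma_\epsilon t}+\delta\}=+\infty\ \text{ a.s.},$$ $$\lim_{\epsilon\to0}P\{|X(t)|\le c_\epsilon|x|e^{-\gamma_\epsilon t}+\delta\ \ \forall t\in[0,T(\epsilon)]\}=1.$$ Moreover, if the exponential stability is uniform in $\epsilon\in(0,\epsilon_0)$ (i.e. $r_\epsilon,c_\epsilon,\gamma_\epsilon$ in the hypothesis can be chosen independent of $\epsilon$), then the constants $r_\epsilon,c_\epsilon,\gamma_\epsilon$ in the conclusion can be taken independent of $\epsilon$.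
   Context: Setting. Let $(\Omega,\mathcal F,P)$ be a complete probability space, $\epsilon_0>0$ fixed and $\epsilon\in(0,\epsilon_0)$ a small parameter. Consider the discrete-time system $$X_{k+1}=X_k+\epsilon f(X_k,Y_{k+1}),\quad k=0,1,2,\dots,\qquad X_0=x\in\mathbb R^n \text{ (deterministic)},$$ where $\{Y_k\}$ is an $\mathbb R^m$-valued stochastic sequence with state space $S_Y\subset\mathbb R^m$, and $f:\mathbb R^n\times\mathbb R^m\to\mathbb R^n$. (A1) $f(x,y)$ is continuous in $(x,y)$; for each $x$, $y\mapsto f(x,y)$ is bounded; and $f$ is locally Lipschitz in $x$ uniformly in $y$: for every compact $D\subset\mathbb R^n$ there is $k_D$ with $|f(x_1,y)-f(x_2,y)|\le k_D|x_1-x_2|$ for all $x_1,x_2\in D$, $y\in S_Y$. (A2) $\{Y_k\}$ is ergodic with invariant distribution $\mu$, in the sense that for each $x$, $\bar f(x):=\int_{S_Y}f(x,y)\mu(dy)=\lim_{N\to\infty}\frac1{N+1}\sum_{k=0}^N f(x,Y_{k+1})$ almost surely. Average systems: the discrete average system $\bar X^{\rm d}_{k+1}=\bar X^{\rm d}_k+\epsilon\bar f(\bar X^{\rm d}_k)$, and the continuous average system $\frac{d}{dt}\bar X^{\rm c}(t)=\bar f(\bar X^{\rm c}(t))$, both with initial value $\bar X^{\rm d}_0=\bar X^{\rm c}(0)=X_0=x$. Continuous-time versions: with $t_k=\epsilon k$, define the piecewise constant processes $X(t)=X_k$ and $\bar X^{\rm d}(t)=\bar X^{\rm d}_k$ for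 $t_k\le t<t_{k+1}$ (these depend on $\epsilon$). *)

(* Defs.v *)
From HB Require Import structures.
From mathcomp Require Import all_boot all_order all_algebra.
From mathcomp Require Import all_classical all_reals all_analysis.
Set Implicit Arguments. Unset Strict Implicit. Unset Printing Implicit Defensive.
Import Order.TTheory GRing.Theory Num.Theory.
Import numFieldNormedType.Exports.
Local Open Scope classical_set_scope.
Local Open Scope ring_scope.

Section Defs.
Variable R : realType.

Definition enorm (n : nat) (x : 'rV[R]_n) : R :=
  Num.sqrt (\sum_(i < n) x ord0 i ^+ 2).

Fixpoint Xseq (T : Type) (n m : nat) (f : 'rV[R]_n -> 'rV[R]_m -> 'rV[R]_n)
  (Y : nat -> T -> 'rV[R]_m) (eps : R) (x : 'rV[R]_n) (w : T) (k : nat)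
  : 'rV[R]_n :=
  match k with
  | 0 => x
  | k'.+1 => Xseq f Y eps x w k' + eps *: f (Xseq f Y eps x w k') (Y k'.+1 w)
  end.

Fixpoint Xbar_d (n : nat) (fbar : 'rV[R]_n -> 'rV[R]_n) (eps : R)
  (x : 'rV[R]_n) (k : nat) : 'rV[R]_n :=
  match k with
  | 0 => x
  | k'.+1 => Xbar_d fbar eps x k' + eps *: fbar (Xbar_d fbar eps x k')
  end.

(* Piecewise constant interpolation: value at t (t >= 0) is the k-th term
   where t_k = eps k <= t < t_{k+1}, i.e. k = floor (t / eps). *)
Definition pc (n : nat) (u : nat -> 'rV[R]_n) (eps t : R) : 'rV[R]_n :=
  u (Num.truncn (t / eps)).

Definition averaging_conclusion (d : measure_display) (T : measurableType d)
  (P : probability T R) (n m : nat)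
  (f : 'rV[R]_n -> 'rV[R]_m -> 'rV[R]_n) (Y : nat -> T -> 'rV[R]_m)
  (eps0 : R) (r c g : R -> R) (Tf : R -> nat) : Prop :=
  (forall M : nat, exists2 e1 : R, 0 < e1 &
     forall eps, 0 < eps -> eps < e1 -> eps < eps0 -> (M <= Tf eps)%N) /\
  forall (x : 'rV[R]_n) (delta : R), 0 < delta ->
    {ae P, forall w,
      forall M : R, exists2 e1 : R, 0 < e1 &
        forall eps, 0 < eps -> eps < e1 -> eps < eps0 -> enorm x < r eps ->
          (M%:E <= ereal_inf (EFin @` [set t : R | (0 <= t /\
               enorm (pc (Xseq f Y eps x w) eps t) >
                 c eps * enorm x * expR (- g eps * t) + delta)%R]))%E}
    /\
    (forall eta : R, 0 < eta -> exists2 e1 : R, 0 < e1 &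
        forall eps, 0 < eps -> eps < e1 -> eps < eps0 -> enorm x < r eps ->
          ((1 - eta)%:E <= P [set w | (forall t : R, 0 <= t <= (Tf eps)%:R ->
               enorm (pc (Xseq f Y eps x w) eps t) <=
                 c eps * enorm x * expR (- g eps * t) + delta)%R])%E).

End Defs.

(* Main.v *)
Require Import Defs.
From HB Require Import structures.
From mathcomp Require Import all_boot all_order all_algebra.
From mathcomp Require Import ring lra.
From mathcomp Require Import all_classical all_reals all_analysis.
From mathcomp Require Import measurable_realfun.
Import Order.TTheory GRing.Theory Num.Theory.
Import numFieldNormedType.Exports.
Local Open Scope classical_set_scope.
Local Open Scope ring_scope.

(* Stability confines the average path to a fixed ball, uniformly in the
   starting point and in [eps]. Cut the time interval [0, M] into finitely many
   blocks; on each block freeze the average path at a point of a finite net of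
   that ball. The accumulated error of [f] against [fbar] along the average path
   is then controlled by the ergodic averages at the net points only, and a
   discrete Gronwall inequality bounds [X - Xbar_d], uniformly in the starting
   point. The event that the averages at the net points have settled from index
   [j] on is measurable and increases to a full event with [j]; this gives the
   almost sure statement, and a diagonal choice of [M] against [eps] gives a
   horizon [Tf] serving all starting points and all tolerances at once. *)

(** * Euclidean norm against the sup norm, and finite nets of balls *)

Section Norms.
Context {R : realType} {n : nat}.
Implicit Types x y : 'rV[R]_n.

Lemma ler_coord_norm x i : `|x ord0 i| <= `|x|.
Proof.
rewrite [leRHS]mx_normrE.
exact: (le_bigmax _ (fun ij : 'I_1 * 'I_n => `|x ij.1 ij.2|) (ord0, i)).
Qed.

Lemma enorm_ge0 x : 0 <= enorm x.
Proof. exact: sqrtr_ge0. Qed.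

Lemma sqr_enorm x : enorm x ^+ 2 = \sum_(i < n) x ord0 i ^+ 2.
Proof. by rewrite sqr_sqrtr// sumr_ge0// => i _; exact: sqr_ge0. Qed.

Lemma ler_coord_enorm x i : `|x ord0 i| <= enorm x.
Proof.
rewrite -ler_sqr ?nnegrE ?enorm_ge0// sqr_enorm real_normK ?num_real//.
by rewrite (bigD1 i)//= lerDl sumr_ge0// => j _; exact: sqr_ge0.
Qed.

Lemma ler_norm_enorm x : `|x| <= enorm x.
Proof.
rewrite [leLHS]mx_normrE; apply/bigmax_leP; split => [|[i j] _ /=].
  exact: enorm_ge0.
by rewrite ord1; exact: ler_coord_enorm.
Qed.

(** The crude factor [n.+1] stays positive when [n] is 0, so that tolerances can be divided by
    it. *)
Lemma ler_enorm_norm x : enorm x <= n.+1%:R * `|x|.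
Proof.
rewrite -ler_sqr ?nnegrE ?enorm_ge0// ?mulr_ge0//.
rewrite sqr_enorm exprMn.
apply: (@le_trans _ _ (\sum_(i < n) `|x| ^+ 2)).
  apply: ler_sum => i _; rewrite -(real_normK (num_real _)).
  by rewrite ler_sqr ?nnegrE// ler_coord_norm.
rewrite sumr_const card_ord -[leLHS]mulr_natl ler_wpM2r ?sqr_ge0//.
by rewrite -natrX ler_nat (leq_trans (leqnSn n))// -[leqLHS]expn1 leq_pexp2l.
Qed.

(** Cauchy-Schwarz, from the squares of [enorm y * x_i - enorm x * y_i] summed over [i]. Zero
    vectors are set apart because the common factor [enorm x * enorm y] is cancelled. *)
Lemma ler_dot_enorm x y :
  \sum_(i < n) x ord0 i * y ord0 i <= enorm x * enorm y.
Proof.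
have [x0|x0] := eqVneq (enorm x) 0.
  rewrite x0 mul0r big1// => i _.
  have := ler_coord_enorm x i; rewrite x0 normr_le0 => /eqP ->.
  by rewrite mul0r.
have [y0|y0] := eqVneq (enorm y) 0.
  rewrite y0 mulr0 big1// => i _.
  have := ler_coord_enorm y i; rewrite y0 normr_le0 => /eqP ->.
  by rewrite mulr0.
have xp : 0 < enorm x by rewrite lt_def x0 enorm_ge0.
have yp : 0 < enorm y by rewrite lt_def y0 enorm_ge0.
suff : \sum_(i < n) 2 * (enorm x * enorm y) * (x ord0 i * y ord0 i) <=
    2 * (enorm x * enorm y) ^+ 2.
  rewrite -mulr_sumr -mulrA ler_pM2l// expr2 ler_pM2l//.
  exact: mulr_gt0.
rewrite [leRHS](_ : _ = \sum_(i < n) ((enorm y * x ord0 i) ^+ 2 +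
    (enorm x * y ord0 i) ^+ 2)); last first.
  rewrite big_split/=; under eq_bigr do rewrite exprMn.
  rewrite -mulr_sumr; under [in X in _ + X]eq_bigr do rewrite exprMn.
  by rewrite -mulr_sumr -!sqr_enorm; ring.
apply: ler_sum => i _; rewrite -subr_ge0.
rewrite (_ : _ - _ = (enorm y * x ord0 i - enorm x * y ord0 i) ^+ 2); last by ring.
exact: sqr_ge0.
Qed.

Lemma ler_enormD x y : enorm (x + y) <= enorm x + enorm y.
Proof.
rewrite -ler_sqr ?nnegrE ?addr_ge0 ?enorm_ge0//.
rewrite sqr_enorm; under eq_bigr do rewrite mxE sqrrD.
rewrite !big_split/= -!sqr_enorm sqrrD lerD2r lerD2l.
by rewrite -mulr2n lerMn2r ler_dot_enorm.
Qed.

Lemma ler_enorm_sub x y : enorm x <= enorm y + n.+1%:R * `|x - y|.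
Proof.
rewrite -[in leLHS](subrK y x) addrC.
by rewrite (le_trans (ler_enormD _ _))// lerD2l ler_enorm_norm.
Qed.

Lemma compact_ball_norm (C : R) : compact [set x : 'rV[R]_n | `|x| <= C].
Proof.
apply: bounded_closed_compact.
  exists C; split; first exact: num_real.
  by move=> D CD x /= xC; rewrite (le_trans xC)// ltW.
rewrite (_ : [set _ | _] = (fun x : 'rV[R]_n => `|x|) @^-1` [set r | r <= C])//.
apply: closed_comp; last exact: closed_le.
by move=> x _; exact: norm_continuous.
Qed.

(** Compactness of the ball. The centres lie in the ball itself, so that bounds valid on the ball
    apply to them. *)
Lemma finite_net (C sigma : R) : 0 < sigma ->
  exists s : seq 'rV[R]_n, (forall y, y \in s -> `|y| <= C) /\
    forall x, `|x| <= C -> exists2 y, y \in s & `|x - y| <= sigma.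
Proof.
move=> s0; have := compact_ball_norm C; rewrite compact_cover.
move=> /(_ _ [set x : 'rV[R]_n | `|x| <= C] (fun x => (ball x sigma)^°)).
case=> [x _|x xC|D DC cD].
- exact: open_interior.
- by exists x => //; exact: nbhsx_ballx.
exists (finmap.enum_fset D); split => [y yD|x xC].
  by have := DC _ yD; rewrite inE.
have [y yD /interior_subset] := cD x xC.
rewrite mx_norm_ball /ball_/= distrC => /ltW xy.
by exists y.
Qed.

End Norms.

(** * Discrete Gronwall inequality and averaging along a slow path *)

Section Deterministic.
Context {R : realType}.

(** Strong induction and a geometric sum. The inequality at [k] may assume the earlier bounds: in
    use, these keep the path where the Lipschitz estimate holds. *)
Lemma discrete_gronwall (u : nat -> R) (kappa a : R) (K : nat) : 0 <= a ->
  (forall k, (k <= K)%N -> (forall j, (j < k)%N -> u j <= kappa * (1 + a) ^+ j) ->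
     u k <= kappa + a * \sum_(j < k) u j) ->
  forall k, (k <= K)%N -> u k <= kappa * (1 + a) ^+ k.
Proof.
move=> a0 H k; elim/ltn_ind: k => k IH kK.
have IH' j : (j < k)%N -> u j <= kappa * (1 + a) ^+ j.
  by move=> jk; apply: IH => //; exact: leq_trans (ltnW jk) kK.
apply: (le_trans (H k kK IH')).
apply: (@le_trans _ _ (kappa + a * \sum_(j < k) kappa * (1 + a) ^+ j)).
  by rewrite lerD2l ler_wpM2l// ler_sum// => j _; exact: IH'.
rewrite -mulr_sumr.
have := subrX1 (1 + a) k; rewrite addrAC subrr add0r => E.
by rewrite mulrCA -E mulrBr mulr1 addrC subrK.
Qed.

Context {V : normedModType R}.

(** Induction on [p], splitting off the last [q] terms; truncated subtraction makes a shorter sum a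
    single block. *)
Lemma norm_sum_blocks (G : nat -> V) (q K : nat) (s W : R) : 0 <= W ->
  (forall a b, (a <= b)%N -> (b <= a + q)%N -> (b <= K)%N ->
    `|\sum_(a <= j < b) G j| <= (b - a)%:R * s + W) ->
  forall p k, (k <= p * q)%N -> (k <= K)%N ->
    `|\sum_(0 <= j < k) G j| <= k%:R * s + p%:R * W.
Proof.
move=> W0 H; elim=> [|p IH] k kp kK.
  move: kp; rewrite mul0n leqn0 => /eqP ->.
  by rewrite big_nil normr0 !mul0r addr0.
have ak : (k - q <= k)%N by exact: leq_subr.
rewrite (big_cat_nat (n := (k - q)%N))//=.
apply: (le_trans (ler_normD _ _)).
have h1 : `|\sum_(0 <= j < k - q) G j| <= (k - q)%:R * s + p%:R * W.
  apply: IH; last exact: leq_trans ak kK.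
  by rewrite leq_subLR; move: kp; rewrite mulSn.
have h2 : `|\sum_(k - q <= j < k) G j| <= (k - (k - q))%:R * s + W.
  by apply: H => //; rewrite addnC -leq_subLR.
apply: (le_trans (lerD h1 h2)).
rewrite (natrB _ ak) -[p.+1]addn1 natrD.
by rewrite le_eqVlt; apply/orP; left; apply/eqP; ring.
Qed.

Variables (F : nat -> V -> V) (Fb : V -> V) (C L B eps : R).
Hypotheses (L0 : 0 <= L) (B0 : 0 <= B) (eps0 : 0 <= eps).
Hypothesis FL : forall k x y, `|x| <= C -> `|y| <= C ->
  `|F k x - F k y| <= L * `|x - y|.
Hypothesis FbL : forall x y, `|x| <= C -> `|y| <= C ->
  `|Fb x - Fb y| <= L * `|x - y|.
Hypothesis FbB : forall x, `|x| <= C -> `|Fb x| <= B.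
Variable xb : nat -> V.
Hypothesis xbS : forall k, xb k.+1 = xb k + eps *: Fb (xb k).
Hypothesis xbC : forall k, `|xb k| <= C.

Lemma slow_variation a l : `|xb (a + l) - xb a| <= eps * l%:R * B.
Proof.
elim: l => [|l IH]; first by rewrite addn0 subrr normr0 mulr0 mul0r.
rewrite addnS xbS addrAC (le_trans (ler_normD _ _))//.
rewrite normrZ (ger0_norm eps0) -addn1 natrD mulrDr mulr1 mulrDl.
by rewrite lerD// ler_wpM2l// FbB.
Qed.

(* On each of the [p] blocks of length [q] the slow path [xb] is frozen at a
   net point, where the partial sums are controlled by [W]. *)
Lemma averaging_along_path (net : set V) (sigma W : R) (p q K : nat) :
  (forall y, net y -> `|y| <= C) ->
  (forall x, `|x| <= C -> exists2 y, net y & `|x - y| <= sigma) ->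
  (forall y N, net y -> (N <= K)%N ->
    `|\sum_(0 <= j < N) (F j y - Fb y)| <= W) ->
  forall k, (k <= p * q)%N -> (k <= K)%N ->
  `|\sum_(0 <= j < k) (F j (xb j) - Fb (xb j))| <=
    k%:R * (2 * L * (eps * q%:R * B + sigma)) + p%:R * (2 * W).
Proof.
move=> netC netP netW.
have W0 : 0 <= W.
  have [y ny _] := netP _ (xbC 0).
  by apply: le_trans (netW y 0 ny (leq0n _)); exact: normr_ge0.
apply: norm_sum_blocks => [|a b ab baq bK]; first by rewrite mulr_ge0.
have [y ny yx] := netP _ (xbC a).
(* Net-point control concerns sums from index 0, so a block is a difference of two of them; hence
   the factor 2 on [W]. *)
have sumB : \sum_(a <= j < b) (F j y - Fb y) =
    \sum_(0 <= j < b) (F j y - Fb y) - \sum_(0 <= j < a) (F j y - Fb y).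
  by rewrite [in RHS](big_cat_nat (n := a))//= addrAC subrr add0r.
(* Freezing the path at [y] costs one Lipschitz error in [F] and one in [Fb]; hence the factor 2 on
   [L]. *)
rewrite (_ : \sum_(a <= j < b) _ =
    \sum_(a <= j < b) ((F j (xb j) - F j y) - (Fb (xb j) - Fb y))
    + \sum_(a <= j < b) (F j y - Fb y)); last first.
  rewrite -big_split/=; apply: eq_bigr => j _.
  by rewrite addrACA subrK -opprD subrK.
apply: (le_trans (ler_normD _ _)); apply: lerD; last first.
  rewrite sumB (le_trans (ler_normB _ _))// mulr_natl mulr2n.
  by rewrite lerD// netW//; exact: leq_trans ab bK.
apply: (le_trans (ler_norm_sum _ _ _)).
rewrite mulr_natl -sumr_const_nat; apply: ler_sum_nat => j /andP[aj jb].
(* Drift since the start of the block, plus the mesh of the net. *)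
have jy : `|xb j - y| <= eps * q%:R * B + sigma.
  rewrite -(subrK (xb a) (xb j)) -addrA (le_trans (ler_normD _ _))//.
  rewrite lerD// -(subnKC aj) (le_trans (slow_variation _ _))//.
  rewrite ler_wpM2r// ler_wpM2l// ler_nat leq_subLR.
  exact: leq_trans (ltnW jb) baq.
rewrite (le_trans (ler_normB _ _))// -mulrA mulr_natl mulr2n lerD//.
  by rewrite (le_trans (FL _ _ _ (xbC j) (netC _ ny)))// ler_wpM2l.
by rewrite (le_trans (FbL _ _ (xbC j) (netC _ ny)))// ler_wpM2l.
Qed.

End Deterministic.

(** * Averaging estimate uniform in the starting point and the step size *)

Section Uniform.
Context {R : realType} {n : nat}.
Notation V := 'rV[R]_n.

(** Sums of at most [j0] terms are bounded termwise by [2 * B]; a longer sum is its length times the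
    deviation of an average, at most [eta] per term. *)
Lemma sum_le_of_average (G : nat -> V) (g : V) (B eta : R) (j0 N K : nat) :
  0 <= B -> 0 <= eta -> (forall k, `|G k - g| <= 2 * B) ->
  (forall N, (j0 <= N)%N -> `|N.+1%:R^-1 *: (\sum_(k < N.+1) G k) - g| <= eta) ->
  (N <= K)%N ->
  `|\sum_(0 <= k < N) (G k - g)| <= eta * K%:R + 2 * B * j0%:R.
Proof.
move=> B0 eta0 GB avg NK; have [Nj|jN] := leqP N j0.
  rewrite (le_trans (ler_norm_sum _ _ _))//.
  rewrite (@le_trans _ _ (\sum_(0 <= k < N) 2 * B))//; first exact: ler_sum.
  rewrite sumr_const_nat subn0 -[leLHS]mulr_natr.
  rewrite (@le_trans _ _ (2 * B * j0%:R))//.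
    by rewrite ler_wpM2l// ?mulr_ge0// ler_nat.
  by rewrite lerDr mulr_ge0.
case: N jN NK => // N jN NK.
rewrite (@le_trans _ _ (eta * N.+1%:R))//; last first.
  rewrite -[leLHS]addr0 lerD// ?mulr_ge0//.
  by rewrite ler_wpM2l// ler_nat.
have N0 : 0 < N.+1%:R :> R by rewrite ltr0n.
rewrite (_ : \sum_(0 <= k < N.+1) _ =
    N.+1%:R *: (N.+1%:R^-1 *: (\sum_(k < N.+1) G k) - g)).
  by rewrite normrZ gtr0_norm// mulrC ler_pM2r// avg.
rewrite scalerBr scalerA divff ?gt_eqF// scale1r big_mkord.
by rewrite sumrB sumr_const card_ord scaler_nat.
Qed.

Variables (Fb : V -> V) (C L B M h : R).
Hypotheses (L0 : 0 < L) (B0 : 0 < B) (M0 : 0 < M) (h0 : 0 < h) (h1 : h <= 1).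
Hypothesis FbL : forall x y : V, `|x| <= C -> `|y| <= C ->
  `|Fb x - Fb y| <= L * `|x - y|.
Hypothesis FbB : forall x : V, `|x| <= C -> `|Fb x| <= B.

(* A Gronwall loop keeps [xs] within distance [h <= 1] of [xb], hence inside
   the ball of radius [C + 1] on which the Lipschitz bound holds. *)
Lemma gronwall_averaging (F : nat -> V -> V) (eps : R) (xs xb : nat -> V) :
  (forall k (x y : V), `|x| <= C + 1 -> `|y| <= C + 1 ->
     `|F k x - F k y| <= L * `|x - y|) ->
  0 < eps ->
  (forall k, xs k.+1 = xs k + eps *: F k (xs k)) ->
  (forall k, xb k.+1 = xb k + eps *: Fb (xb k)) ->
  xs 0%N = xb 0%N -> (forall k, `|xb k| <= C) ->
  (forall k, eps * k%:R <= M ->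
    eps * `|\sum_(0 <= j < k) (F j (xb j) - Fb (xb j))| <= h * expR (- (L * M))) ->
  forall k, eps * k%:R <= M -> `|xs k - xb k| <= h.
Proof.
move=> FL eps0 xsS xbS x0 xbC small k0 k0M.
(* The Gronwall factor is at most [expR (eps * L * k)], hence at most [expR (L * M)] up to time
   [M]. *)
have growth k : (k <= k0)%N ->
    h * expR (- (L * M)) * (1 + eps * L) ^+ k <= h.
  move=> kk0; rewrite -mulrA ler_piMr ?(ltW h0)//.
  rewrite (@le_trans _ _ (expR (- (L * M)) * expR (L * M)))//; last first.
    by rewrite -expRD addNr expR0.
  rewrite ler_wpM2l ?expR_ge0//.
  rewrite (@le_trans _ _ (expR (eps * L) ^+ k))//.
    rewrite lerXn2r ?nnegrE ?expR_ge0 ?addr_ge0 ?mulr_ge0 ?(ltW eps0) ?(ltW L0)//.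
    exact: expR_ge1Dx.
  rewrite -expRM_natr ler_expR mulrAC mulrC ler_pM2l// (le_trans _ k0M)//.
  by rewrite ler_pM2l// ler_nat.
(* The error splits into a Lipschitz part, fed back to Gronwall, and the averaging error along [xb]
   alone, bounded by [small]. *)
have diff k : xs k - xb k =
    eps *: \sum_(0 <= j < k) (F j (xs j) - F j (xb j)) +
    eps *: \sum_(0 <= j < k) (F j (xb j) - Fb (xb j)).
  elim: k => [|k IH]; first by rewrite x0 subrr !big_nil scaler0 addr0.
  rewrite xsS xbS opprD addrACA IH !big_nat_recr//=.
  rewrite [X in _ = X + _]scalerDr [X in _ = _ + X]scalerDr.
  rewrite [RHS]addrACA; congr (_ + _).
  by rewrite -scalerDr addrA subrK scalerBr.
suff /(_ k0 (leqnn _)) H : forall k, (k <= k0)%N ->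
    `|xs k - xb k| <= h * expR (- (L * M)) * (1 + eps * L) ^+ k.
  exact: le_trans H (growth _ _).
apply: discrete_gronwall => [|k kk0 IH].
  by rewrite mulr_ge0 ?(ltW eps0) ?(ltW L0).
rewrite diff addrC (le_trans (ler_normD _ _))// !normrZ gtr0_norm//.
rewrite lerD//.
  by apply: small; rewrite (le_trans _ k0M)// ler_pM2l// ler_nat.
rewrite -mulrA ler_pM2l// mulr_sumr (le_trans (ler_norm_sum _ _ _))//.
rewrite big_mkord; apply: ler_sum => j _.
apply: FL; last by rewrite (le_trans (xbC _))// lerDl.
rewrite -(subrK (xb j) (xs j)) addrC (le_trans (ler_normD _ _))// lerD//.
rewrite (le_trans (IH _ _))// (le_trans (growth _ _))//.
exact: leq_trans (ltnW _) kk0.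
Qed.

(** The order of quantifiers matters: net and tolerance precede [j0], and the threshold [e1] depends
    on [j0] but not on [F], so it will serve all sample points whose averages settle by [j0]. *)
Lemma uniform_averaging :
  exists (s : seq V) (eta : R), 0 < eta /\
  forall j0 : nat, exists2 e1 : R, 0 < e1 &
  forall (F : nat -> V -> V),
  (forall k (x y : V), `|x| <= C + 1 -> `|y| <= C + 1 ->
     `|F k x - F k y| <= L * `|x - y|) ->
  (forall k (x : V), `|x| <= C -> `|F k x| <= B) ->
  (forall (y : V) N, y \in s -> (j0 <= N)%N ->
     `|N.+1%:R^-1 *: (\sum_(k < N.+1) F k y) - Fb y| <= eta) ->
  forall (eps : R) (xs xb : nat -> V), 0 < eps -> eps < e1 ->
  (forall k, xs k.+1 = xs k + eps *: F k (xs k)) ->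
  (forall k, xb k.+1 = xb k + eps *: Fb (xb k)) ->
  xs 0%N = xb 0%N -> (forall k, `|xb k| <= C) ->
  forall k, eps * k%:R <= M -> `|xs k - xb k| <= h.
Proof.
(* Error budget, amplified by Gronwall to at most [h]. Five sources get [kap / 5] each: the mesh
   [sigma], the block duration [M / p], the rounding of block lengths, the tolerance [eta], and the
   [j0] unsettled terms. *)
pose kap := h * expR (- (L * M)).
have kap0 : 0 < kap by rewrite mulr_gt0// expR_gt0.
pose sigma := kap / (10 * (L * M)).
have LM0 : 0 < L * M by exact: mulr_gt0.
have sigma0 : 0 < sigma by rewrite divr_gt0// mulr_gt0.
(* Enough blocks that the drift [B * M / p] in one of them, weighted by [2 * (L * M)], stays within
   its share. *)
pose p := (Num.truncn (10 * (L * M) * (B * M) / kap)).+1.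
have p0 : 0 < p%:R :> R by rewrite ltr0n.
have pP : 2 * (L * M) * (B * M) / p%:R <= kap / 5.
  have : 10 * (L * M) * (B * M) / kap < p%:R.
    have := @truncn_itv _ (10 * (L * M) * (B * M) / kap).
    have -> : 0 <= 10 * (L * M) * (B * M) / kap.
      by rewrite divr_ge0// ?(ltW kap0)// !mulr_ge0 ?(ltW L0) ?(ltW B0) ?(ltW M0).
    by move=> /(_ isT)/andP[].
  by rewrite !ltr_pdivrMr// !ler_pdivrMr// => ?; lra.
pose eta := kap / (10 * (p%:R * M)).
have pM0 : 0 < p%:R * M by exact: mulr_gt0.
have eta0 : 0 < eta by rewrite divr_gt0// mulr_gt0.
have [s [sC sP]] := @finite_net R n C sigma sigma0.
exists s, eta; split => // j0.
have LMB0 : 0 < L * M * B by exact: mulr_gt0.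
have pB0 : 0 < p%:R * B * j0.+1%:R by rewrite !mulr_gt0.
(* The first bound absorbs the rounding of block lengths, the second the unsettled terms; [j0.+1]
   keeps the divisor positive when [j0] is 0. *)
exists (Num.min (kap / (10 * (L * M * B))) (kap / (20 * (p%:R * B * j0.+1%:R)))).
  by rewrite lt_min !divr_gt0// mulr_gt0.
move=> F FL FB avg eps xs xb eps0; rewrite lt_min => /andP[epsl epsr].
move=> xsS xbS x0 xbC; apply: (gronwall_averaging _ _ _ _ FL eps0 xsS xbS x0 xbC) => k kM.
(* [p] blocks of [q] steps cover the time interval up to [M]; rounding up lengthens a block by at
   most [eps]. *)
pose q := (Num.truncn (M / (eps * p%:R))).+1.
have /andP[q1 q2] : q.-1%:R <= M / (eps * p%:R) < q%:R.
  by rewrite truncn_itv// divr_ge0 ?mulr_ge0 ?(ltW M0) ?(ltW eps0).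
have epsq : eps * q%:R <= M / p%:R + eps.
  rewrite /q -addn1 natrD mulrDr mulr1 lerD2r//.
  rewrite ler_pdivlMr//; move: q1; rewrite ler_pdivlMr ?mulr_gt0//=.
  by rewrite mulrCA mulrA.
have kpq : (k <= p * q)%N.
  rewrite -(ler_nat R) natrM -(ler_pM2l eps0) (le_trans kM)//.
  by move: q2; rewrite ltr_pdivrMr ?mulr_gt0// => ?; lra.
have C1 (x : V) : `|x| <= C -> `|x| <= C + 1 by move=> xC; rewrite (le_trans xC)// lerDl.
have main := @averaging_along_path R V F Fb C L B eps (ltW L0) (ltW B0) (ltW eps0)
  (fun k x y xC yC => FL k x y (C1 _ xC) (C1 _ yC)) FbL FbB xb xbS xbC
  [set y | y \in s] sigma (eta * k%:R + 2 * B * j0%:R) p q k sC sP.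
have {main} := main _ k kpq (leqnn _).
move=> main; rewrite -/kap.
have {}main : `|\sum_(0 <= j < k) (F j (xb j) - Fb (xb j))| <=
    k%:R * (2 * L * (eps * q%:R * B + sigma)) + p%:R * (2 * (eta * k%:R + 2 * B * j0%:R)).
  apply: main => y N /= ys Nk.
  apply: (sum_le_of_average _ _ _ _ _ _ _ (ltW B0) (ltW eta0) _ _ Nk)
    => [j|N' jN']; last exact: avg.
  by rewrite (le_trans (ler_normB _ _))// mulr_natl mulr2n lerD ?FB ?FbB ?sC.
apply: (@le_trans _ _ (eps * k%:R * (2 * L * (eps * q%:R * B + sigma)) +
    (2 * (p%:R * eta * (eps * k%:R)) + 4 * (p%:R * B * j0%:R * eps)))).
  rewrite -(ler_pM2l eps0) in main; apply: (le_trans main).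
  by rewrite le_eqVlt; apply/orP; left; apply/eqP; ring.
have t1 : eps * k%:R * (2 * L * (eps * q%:R * B + sigma)) <=
    M * (2 * L * ((M / p%:R + eps) * B + sigma)).
  have eq0 : 0 <= eps * q%:R * B + sigma.
    by rewrite addr_ge0 ?(ltW sigma0)// !mulr_ge0 ?(ltW eps0) ?(ltW B0).
  apply: ler_pM => //; first by rewrite mulr_ge0 ?(ltW eps0).
    by rewrite !mulr_ge0 ?(ltW L0).
  by rewrite ler_pM2l ?mulr_gt0// lerD2r ler_pM2r.
have t2 : p%:R * eta * (eps * k%:R) <= kap / 10.
  rewrite (@le_trans _ _ (p%:R * eta * M))//.
    by rewrite ler_pM2l// mulr_gt0.
  rewrite le_eqVlt; apply/orP; left; apply/eqP; rewrite /eta; field.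
  by rewrite (gt_eqF M0) pnatr_eq0.
have t3 : p%:R * B * j0%:R * eps <= kap / 20.
  rewrite (@le_trans _ _ (p%:R * B * j0.+1%:R * eps))//.
    by rewrite ler_pM2r// ler_pM2l ?mulr_gt0// ler_nat.
  by move: epsr; rewrite ltr_pdivlMr ?mulr_gt0// => ?; lra.
have t4 : L * M * B * eps <= kap / 10.
  by move: epsl; rewrite ltr_pdivlMr ?mulr_gt0// => ?; lra.
have t5 : L * M * sigma = kap / 10.
  rewrite /sigma; field.
  by rewrite (gt_eqF M0) (gt_eqF L0).
have t6 : M * (2 * L * ((M / p%:R + eps) * B + sigma)) =
   2 * (L * M) * (B * M) / p%:R + 2 * (L * M * B * eps) + 2 * (L * M * sigma) by ring.
lra.
Qed.

End Uniform.

(** * Measurability of continuous functions of two random vectors *)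

Section Measurability.
Context {R : realType} {d : measure_display} {Omega : measurableType d}.

Lemma norm_lt_coord {n} (x : 'rV[R]_n) (e : R) : 0 < e ->
  (`|x| < e) <-> (forall i, `|x ord0 i| < e).
Proof.
move=> e0; split=> [xe i|H]; first exact: le_lt_trans (ler_coord_norm x i) xe.
rewrite [ltLHS]mx_normrE; apply/bigmax_ltP; split => // -[i j] _ /=.
by rewrite ord1.
Qed.

Lemma rat_approx {n} (x : 'rV[R]_n) (e : R) : 0 < e ->
  exists q : 'rV[rat]_n, `|x - map_mx ratr q| < e.
Proof.
move=> e0.
have H i : exists q : rat, `|x ord0 i - ratr q| < e.
  have [|q] := @rat_in_itvoo R (x ord0 i - e) (x ord0 i + e); first by lra.
  by rewrite in_itv/= => qx; exists q; rewrite distrC ltr_distl.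
have [q qP] := choice H.
exists (\row_i q i); apply/norm_lt_coord => // i.
by rewrite !mxE.
Qed.

Lemma measurable_norm_sub_lt {n} (u : Omega -> 'rV[R]_n) (q : 'rV[R]_n) (e : R) :
  0 < e -> (forall i, measurable_fun setT (fun w => u w ord0 i)) ->
  measurable [set w | `|u w - q| < e].
Proof.
move=> e0 mu.
rewrite (_ : [set _ | _] =
    \bigcap_(i in [set: 'I_n]) [set w | `|u w ord0 i - q ord0 i| < e]).
  apply: fin_bigcap_measurable => [|i _]; first exact: finite_finset.
  rewrite -[X in measurable X]setTI.
  have -> : [set w | `|u w ord0 i - q ord0 i| < e] =
     (fun w => u w ord0 i) @^-1` (ball (q ord0 i) e).
    by apply/seteqP; split=> w /=; rewrite /ball/= distrC.
  by apply: mu => //; exact: measurable_ball.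
apply/seteqP; split=> w /=.
  by move=> /norm_lt_coord => /(_ e0) H i _; have := H i; rewrite !mxE.
by move=> H; apply/norm_lt_coord => // i; have := H i Logic.I; rewrite !mxE.
Qed.

Context {n m : nat} {u : Omega -> 'rV[R]_n} {v : Omega -> 'rV[R]_m}.
Hypothesis mu : forall i, measurable_fun setT (fun w => u w ord0 i).
Hypothesis mv : forall i, measurable_fun setT (fun w => v w ord0 i).

(* An open set of the product is a countable union of rational boxes. *)
Lemma measurable_preimage_open (U : set ('rV[R]_n * 'rV[R]_m)) : open U ->
  measurable [set w | U (u w, v w)].
Proof.
move=> oU.
pose box (t : 'rV[rat]_n * 'rV[rat]_m * nat) :
    set ('rV[R]_n * 'rV[R]_m) := [set p |
  `|p.1 - map_mx ratr t.1.1| < t.2.+1%:R^-1 /\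
  `|p.2 - map_mx ratr t.1.2| < t.2.+1%:R^-1].
rewrite (_ : [set _ | _] = \bigcup_t
    [set w | box t `<=` U /\ box t (u w, v w)]); last first.
  apply/seteqP; split=> [w /= Uw|w [t _ [/= + H]]]; last exact.
  have /nbhs_ballP[e /= e0 eU] : nbhs (u w, v w) U by exact: open_nbhs_nbhs.
  (* One half bounds the distance to the rational centre, the other the size of the box. *)
  have e20 : 0 < e / 2 by rewrite divr_gt0.
  pose k := Num.truncn (e / 2)^-1.
  have k0 : 0 < k.+1%:R^-1 :> R by rewrite invr_gt0 ltr0n.
  have ke : k.+1%:R^-1 < e / 2.
    rewrite invf_plt ?posrE ?ltr0n//.
    by have := @truncn_itv R (e / 2)^-1; rewrite invr_ge0 (ltW e20) => /(_ isT)/andP[].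
  have [q1 q1P] := rat_approx (u w) _ k0.
  have [q2 q2P] := rat_approx (v w) _ k0.
  exists (q1, q2, k) => //=; split => //= -[a b] [/= a1 b1].
  apply: eU; split; rewrite mx_norm_ball /ball_/=.
    rewrite -(subrK (map_mx ratr q1) (u w)) -addrA.
    apply: le_lt_trans (ler_normD _ _) _.
    rewrite [ltRHS]splitr ltrD//; first exact: lt_trans q1P ke.
    by rewrite distrC; exact: lt_trans a1 ke.
  rewrite -(subrK (map_mx ratr q2) (v w)) -addrA.
  apply: le_lt_trans (ler_normD _ _) _.
  rewrite [ltRHS]splitr ltrD//; first exact: lt_trans q2P ke.
  by rewrite distrC; exact: lt_trans b1 ke.
apply: countable_bigcupT_measurable => [|t]; first exact: countableP.
have [tU|tU] := pselect (box t `<=` U); last first.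
  by rewrite (_ : [set _ | _] = set0)//; apply/seteqP; split => w // -[].
have t0 : 0 < t.2.+1%:R^-1 :> R by rewrite invr_gt0 ltr0n.
rewrite (_ : [set _ | _] =
  [set w | `|u w - map_mx ratr t.1.1| < t.2.+1%:R^-1] `&`
  [set w | `|v w - map_mx ratr t.1.2| < t.2.+1%:R^-1]); last first.
  by apply/seteqP; split => w /=; [case|split].
by apply: measurableI; apply: measurable_norm_sub_lt.
Qed.

Lemma measurable_continuous_comp2 (g : 'rV[R]_n * 'rV[R]_m -> R) :
  continuous g -> measurable_fun setT (fun w => g (u w, v w)).
Proof.
move=> cg; apply: (measurability _ (RGenOInfty.measurableE R)).
move=> /= _ [_ [a ->] <-]; rewrite setTI.
apply: (@measurable_preimage_open (g @^-1` `]a, +oo[%classic)).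
by apply: open_comp => [x _|]; [exact: cg|exact: interval_open].
Qed.

End Measurability.

(** * Measurability of norms of random vectors *)

Section MeasurableVectors.
Context {R : realType} {d : measure_display} {Omega : measurableType d} {n : nat}.
Context {u : Omega -> 'rV[R]_n}.
Hypothesis mu : forall i, measurable_fun setT (fun w => u w ord0 i).

Lemma measurable_norm_le (e : R) : measurable [set w | `|u w| <= e].
Proof.
have mn : measurable_fun setT (fun w => `|u w|).
  apply: (measurable_continuous_comp2 mu mu (fun p => `|p.1|)).
  move=> p; apply: (@continuous_comp _ _ _ fst (fun x : 'rV[R]_n => `|x|)).
    exact: cvg_fst.
  exact: norm_continuous.
rewrite -[X in measurable X]setTI.
rewrite (_ : [set _ | _] = (fun w => `|u w|) @^-1` `]-oo, e]%classic).
  exact: mn.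
by apply/seteqP; split=> w /=; rewrite in_itv.
Qed.

Lemma measurable_enorm : measurable_fun setT (fun w => enorm (u w)).
Proof.
apply: (@measurableT_comp _ _ _ _ _ _ (@Num.sqrt R)).
  by apply: continuous_measurable_fun; exact: sqrt_continuous.
by apply: measurable_sum => i; exact: measurable_funX.
Qed.

End MeasurableVectors.

(** * Diagonal choice of the horizon; bounds on limits of averages *)

Section Horizon.
Context {R : realType}.

(** Take the largest [i] up to [eps^-1] with [eps < e i]: the cap keeps the maximum finite yet
    passes every [M] as [eps] shrinks. An empty maximum is 0, whence the guard [0 < Tf eps]. *)
Lemma diagonal_horizon (e : nat -> R) : (forall M, 0 < e M) ->
  exists Tf : R -> nat,
    (forall M, exists2 e1 : R, 0 < e1 &
       forall eps, 0 < eps -> eps < e1 -> (M <= Tf eps)%N) /\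
    (forall eps, (0 < Tf eps)%N -> eps < e (Tf eps)).
Proof.
move=> e0.
exists (fun eps => \max_(i < (Num.truncn eps^-1).+1 | eps < e i) (i : nat)).
split=> [M|eps].
  exists (Num.min (e M) M.+1%:R^-1).
    by rewrite lt_min e0 invr_gt0 ltr0n.
  move=> eps eps0; rewrite lt_min => /andP[epse epsM].
  have MT : (M < (Num.truncn eps^-1).+1)%N.
    rewrite ltnS truncn_ge_nat ?invr_ge0 ?(ltW eps0)//.
    rewrite (@le_trans _ _ M.+1%:R) ?ler_nat//.
    by rewrite -[leLHS]invrK lef_pV2 ?posrE ?invr_gt0 ?ltr0n// ltW.
  exact: (@leq_bigmax_cond _ _ (fun i : 'I__ => i : nat) (Ordinal MT)).
elim/big_ind: _ => // a b IHa IHb.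
by case: (leqP a b) => _.
Qed.

Lemma average_norm_le {n} (G : nat -> 'rV[R]_n) (g : 'rV[R]_n) (B : R) :
  (fun N : nat => N.+1%:R^-1 *: \sum_(k < N.+1) G k) @ \oo --> g ->
  (forall k, `|G k| <= B) -> `|g| <= B.
Proof.
move=> Gg GB.
apply: (@closed_cvg _ _ \oo _ _ (fun x : 'rV[R]_n => `|x| <= B) _ _ _ Gg).
  rewrite (_ : (fun _ => _) = (fun x : 'rV[R]_n => `|x|) @^-1` [set r | r <= B])//.
  by apply: closed_comp; [move=> x _; exact: norm_continuous|exact: closed_le].
near=> N; have N0 : 0 < N.+1%:R :> R by rewrite ltr0n.
rewrite normrZ gtr0_norm ?invr_gt0// mulrC ler_pdivrMr//.
rewrite (le_trans (ler_norm_sum _ _ _))// (@le_trans _ _ (\sum_(k < N.+1) B))//.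
  exact: ler_sum.
by rewrite sumr_const card_ord mulr_natr.
Unshelve. all: by end_near. Qed.

End Horizon.

(** * Probabilistic averaging: settled events and the two limit statements *)

Section Averaging.
Context {R : realType} {d : measure_display} {Omega : measurableType d}
  {P : probability Omega R} {n m : nat} {eps0 : R}
  {f : 'rV[R]_n -> 'rV[R]_m -> 'rV[R]_n} {Y : nat -> Omega -> 'rV[R]_m}
  {S_Y : set 'rV[R]_m} {fbar : 'rV[R]_n -> 'rV[R]_n}.
Hypothesis mY : forall k (i : 'I_m), measurable_fun setT (fun w => Y k w ord0 i).
Hypothesis YS : forall k w, S_Y (Y k w).
Hypothesis fC : continuous (fun p : 'rV[R]_n * 'rV[R]_m => f p.1 p.2).
Hypothesis fB : forall x, exists M : R, forall y, S_Y y -> enorm (f x y) <= M.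
Hypothesis fL : forall D : set 'rV[R]_n, compact D -> exists kD : R,
  forall x1 x2 y, D x1 -> D x2 -> S_Y y ->
    enorm (f x1 y - f x2 y) <= kD * enorm (x1 - x2).
Hypothesis fE : forall x, {ae P, forall w,
     (fun N : nat => (N.+1%:R)^-1 *: \sum_(k < N.+1) f x (Y k.+1 w))
       @ \oo --> fbar x}.

(** Boundedness of [f] is assumed for each [x] separately; the Lipschitz bound spreads it from [0]
    over the ball. The added 1 makes the constants positive. *)
Lemma lipschitz_bounded_ball (C : R) : 0 <= C -> exists L B : R,
  [/\ 0 < L, 0 < B,
    forall x y z, `|x| <= C -> `|y| <= C -> S_Y z ->
      `|f x z - f y z| <= L * `|x - y| &
    forall x z, `|x| <= C -> S_Y z -> `|f x z| <= B].
Proof.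
move=> C0; have [kD kP] := fL _ (compact_ball_norm C).
have [M0 M0P] := fB 0.
pose L := `|kD| * n.+1%:R + 1.
have L0 : 0 < L by rewrite ltr_wpDl// mulr_ge0.
have LP x y z : `|x| <= C -> `|y| <= C -> S_Y z ->
      `|f x z - f y z| <= L * `|x - y|.
  move=> xC yC zS; rewrite (le_trans (ler_norm_enorm _))//.
  rewrite (le_trans (kP _ _ _ xC yC zS))//.
  rewrite (@le_trans _ _ (`|kD| * enorm (x - y)))//.
    by rewrite ler_wpM2r ?enorm_ge0// ler_norm.
  rewrite (@le_trans _ _ (`|kD| * (n.+1%:R * `|x - y|)))//.
    by rewrite ler_wpM2l// ler_enorm_norm.
  by rewrite mulrA ler_wpM2r// lerDl.
exists L, (`|M0| + L * C + 1); split => //.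
  by rewrite ltr_wpDl// addr_ge0// mulr_ge0// ltW.
move=> x z xC zS.
have := LP x 0 z xC _ zS; rewrite normr0 subr0 => /(_ C0) H.
rewrite -(subrK (f 0 z) (f x z)) (le_trans (ler_normD _ _))//.
have h1 : `|f 0 z| <= `|M0|.
  by rewrite (le_trans (ler_norm_enorm _))// (le_trans (M0P _ zS))// ler_norm.
have h2 : L * `|x| <= L * C by rewrite ler_pM2l.
lra.
Qed.

(** A full event is nonempty, so almost sure convergence provides actual sample points. *)
Lemma ae_properfilter : ProperFilter (almost_everywhere P).
Proof.
have : (0 < P setT)%E by rewrite probability_setT.
exact: ae_properfilter_algebraOfSetsType.
Qed.

(** At one sample point where both averages converge, the averaged differences obey the bound on
    [f], and closed balls keep it in the limit. *)
Lemma fbar_lipschitz (C L : R) :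
  (forall x y z, `|x| <= C -> `|y| <= C -> S_Y z ->
      `|f x z - f y z| <= L * `|x - y|) ->
  forall x y : 'rV[R]_n, `|x| <= C -> `|y| <= C ->
    `|fbar x - fbar y| <= L * `|x - y|.
Proof.
move=> H x y xC yC.
have [w [wx wy]] := @filter_ex _ _ ae_properfilter _ (filterI (fE x) (fE y)).
apply: (@average_norm_le _ _ (fun k => f x (Y k.+1 w) - f y (Y k.+1 w))) => [|k].
  under eq_fun do rewrite sumrB scalerBr.
  exact: cvgB.
exact: H.
Qed.

Lemma fbar_bounded (C B : R) :
  (forall x z, `|x| <= C -> S_Y z -> `|f x z| <= B) ->
  forall x : 'rV[R]_n, `|x| <= C -> `|fbar x| <= B.
Proof.
move=> H x xC; have [w wx] := @filter_ex _ _ ae_properfilter _ (fE x).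
by apply: (average_norm_le (fun k => f x (Y k.+1 w)) _ _ wx) => k; exact: H.
Qed.

Lemma measurable_f (u : Omega -> 'rV[R]_n) k :
  (forall i, measurable_fun setT (fun w => u w ord0 i)) ->
  forall i, measurable_fun setT (fun w : Omega => f (u w) (Y k w) ord0 i).
Proof.
move=> mu i.
apply: (measurable_continuous_comp2 mu (mY k) (fun p => f p.1 p.2 ord0 i)).
move=> p; apply: (@continuous_comp _ _ _ (fun p => f p.1 p.2)
  (fun M : 'rV[R]_n => M ord0 i)); first exact: fC.
exact: coord_continuous.
Qed.

Lemma measurable_Xseq eps x k i :
  measurable_fun setT (fun w => Xseq f Y eps x w k ord0 i).
Proof.
elim: k i => [|k IH] i /=; first exact: measurable_cst.
under eq_fun do rewrite 2!mxE.
apply: measurable_funD; first exact: IH.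
by apply: measurable_funM; [exact: measurable_cst|exact: measurable_f].
Qed.

(** The interpolation takes one value per index [k], so the uncountably many conditions on [t]
    become one per [k]: membership of a norm in a down-closed set, which is an interval. *)
Lemma measurable_event eps x (T : R) (phi : R -> R) :
  measurable [set w | forall t : R, 0 <= t <= T ->
    enorm (pc (Xseq f Y eps x w) eps t) <= phi t].
Proof.
rewrite (_ : [set _ | _] = \bigcap_k ((fun w => enorm (Xseq f Y eps x w k)) @^-1`
   [set z | forall t : R, 0 <= t <= T -> Num.truncn (t / eps) = k -> z <= phi t])).
  apply: bigcapT_measurable => k; rewrite -[X in measurable X]setTI.
  apply: measurable_enorm => //; first by move=> i; exact: measurable_Xseq.
  apply: is_interval_measurable => a b /= _ bP c /andP[_ cb] t tT tk.
  exact: le_trans cb (bP t tT tk).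
apply/seteqP; split=> [w /= H k _ t tT <-|w /= H t tT]; first exact: H.
exact: (H _ Logic.I t tT erefl).
Qed.

Definition settled (s : seq 'rV[R]_n) (eta : R) (j : nat) : set Omega :=
  [set w | forall y N, y \in s -> (j <= N)%N ->
    `|N.+1%:R^-1 *: (\sum_(k < N.+1) f y (Y k.+1 w)) - fbar y| <= eta].

Lemma measurable_settled s eta j : measurable (settled s eta j).
Proof.
(* Indexing the net points by their position in [s] gives a countable intersection. *)
rewrite (_ : settled s eta j = \bigcap_l \bigcap_N [set w |
    (l < size s)%N -> (j <= N)%N ->
    `|N.+1%:R^-1 *: (\sum_(k < N.+1) f s`_l (Y k.+1 w)) - fbar s`_l| <= eta]).
  apply: bigcapT_measurable => l; apply: bigcapT_measurable => N.
  have [ls|ls] := ltnP l (size s); last first.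
    by rewrite (_ : [set _ | _] = setT)//; apply/seteqP; split.
  have [jN|jN] := leqP j N; last first.
    by rewrite (_ : [set _ | _] = setT)//; apply/seteqP; split.
  rewrite (_ : [set _ | _] = [set w |
    `|N.+1%:R^-1 *: (\sum_(k < N.+1) f s`_l (Y k.+1 w)) - fbar s`_l| <= eta]).
    apply: measurable_norm_le => i; under eq_fun do rewrite 3!mxE summxE.
    apply: measurable_funD; last exact: measurable_cst.
    apply: measurable_funM; first exact: measurable_cst.
    apply: measurable_sum => k.
    by apply: (measurable_f (fun _ => s`_l)) => i'; exact: measurable_cst.
  by apply/seteqP; split=> w /=; [exact|].
apply/seteqP; split=> w /= H.
  by move=> l _ N _ /= ls jN; apply: H => //; exact: mem_nth.
move=> y N ys jN; have := H (index y s) Logic.I N Logic.I.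
by rewrite /= nth_index// index_mem; exact.
Qed.

Lemma settled_nondecreasing s eta :
  {homo settled s eta : i j / (i <= j)%N >-> (i <= j)%O}.
Proof.
move=> i j ij; apply/subsetPset => w H y N ys jN.
by apply: H => //; exact: leq_trans ij jN.
Qed.

Lemma settled_of_cvg s eta w : 0 < eta ->
  (forall y, y \in s -> (fun N : nat => (N.+1%:R)^-1 *: \sum_(k < N.+1) f y (Y k.+1 w))
       @ \oo --> fbar y) ->
  exists j, settled s eta j w.
Proof.
move=> eta0; elim: s => [|x s IH] H; first by exists 0%N.
have [j1 j1P] : exists j, settled s eta j w.
  by apply: IH => y ys; apply: H; rewrite inE ys orbT.
have /cvgrPdist_le/(_ eta eta0)[j2 _ j2P] := H x (mem_head _ _).
exists (maxn j1 j2) => y N; rewrite inE geq_max => /orP[/eqP ->|ys] /andP[N1 N2].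
  by rewrite distrC; exact: j2P.
exact: j1P.
Qed.

Lemma ae_cvg_seq (s : seq 'rV[R]_n) : {ae P, forall w, forall y, y \in s ->
   (fun N : nat => (N.+1%:R)^-1 *: \sum_(k < N.+1) f y (Y k.+1 w)) @ \oo --> fbar y}.
Proof.
elim: s => [|x s IH]; first by apply: filterE.
move: (fE x) IH; apply: filterS2 => w xw sw y; rewrite inE => /orP[/eqP ->//|].
exact: sw.
Qed.

(** Continuity from below: the settled events increase to a set containing the event of convergence
    at all points of [s]. *)
Lemma probability_settled s eta a : 0 < eta -> 0 < a ->
  exists j, ((1 - a)%:E <= P (settled s eta j))%E.
Proof.
move=> eta0 a0.
have mU : measurable (\bigcup_j settled s eta j).
  by apply: bigcupT_measurable => j; exact: measurable_settled.
have PU : P (\bigcup_j settled s eta j) = 1%E.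
  rewrite -[X in P X]setCK probability_setC; last exact: measurableC.
  suff -> : P (~` \bigcup_j settled s eta j) = 0%E by rewrite sube0.
  apply: measure_negligible; first exact: measurableC.
  apply: negligibleS (ae_cvg_seq s) => w /= wU H; apply: wU.
  by have [j jw] := settled_of_cvg s eta w eta0 H; exists j.
have cv : P \o settled s eta @ \oo --> 1%E.
  rewrite -PU; apply: nondecreasing_cvg_mu => //.
    by move=> j; exact: measurable_settled.
  exact: settled_nondecreasing.
apply: contrapT => /forallNP H.
have : (1 <= (1 - a)%:E)%E.
  apply: (cvge_le _ cv); near=> j.
  by have /negP := H j; rewrite -ltNge => /ltW.
by rewrite lee_fin; lra.
Unshelve. all: by end_near. Qed.

Variables (r c g : R -> R) (C : R).
Hypothesis C0 : 0 <= C.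
Hypothesis cg : forall eps, 0 < eps -> eps < eps0 -> [/\ 0 < c eps, 0 < g eps &
  c eps * r eps <= C].
Hypothesis stable : forall eps, 0 < eps -> eps < eps0 ->
  forall x, enorm x < r eps -> forall t, 0 <= t ->
    enorm (pc (Xbar_d fbar eps x) eps t) <= c eps * enorm x * expR (- g eps * t).

(** At time [eps * k] the interpolation is the [k]-th term, and the stability bound is at most
    [c eps * r eps]. *)
Lemma bounded_average eps x k : 0 < eps -> eps < eps0 -> enorm x < r eps ->
  `|Xbar_d fbar eps x k| <= C.
Proof.
move=> e0 e1 xr; have [c0 g0 crC] := cg _ e0 e1.
have t0 : 0 <= eps * k%:R by rewrite mulr_ge0// ltW.
have := stable _ e0 e1 _ xr _ t0.
rewrite /pc mulrAC divff ?gt_eqF// mul1r natrK => H.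
rewrite (le_trans (ler_norm_enorm _))// (le_trans H)//.
rewrite (@le_trans _ _ (c eps * enorm x))//.
  rewrite ler_piMr ?mulr_ge0 ?enorm_ge0 ?(ltW c0)//.
  by rewrite expR_le1 mulNr oppr_le0 mulr_ge0// ltW.
by rewrite (le_trans _ crC)// ler_pM2l// ltW.
Qed.

(** [e1] precedes [w] and [x], so a settled event lies inside the good event for every admissible
    [x] and [eps]; its probability then bounds that of the good event. *)
Lemma averaging_on_settled (M h : R) : 0 <= M -> 0 < h ->
  exists (s : seq 'rV[R]_n) (eta : R), 0 < eta /\
  forall j, exists2 e1 : R, 0 < e1 &
  forall w, settled s eta j w ->
  forall eps x, 0 < eps -> eps < e1 -> eps < eps0 -> enorm x < r eps ->
  forall t, 0 <= t <= M ->
    enorm (pc (Xseq f Y eps x w) eps t) <=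
      c eps * enorm x * expR (- g eps * t) + h.
Proof.
move=> M0 h0.
have [L [B [L0 B0 LP BP]]] := @lipschitz_bounded_ball (C + 1) (addr_ge0 C0 ler01).
have C1 (x : 'rV[R]_n) : `|x| <= C -> `|x| <= C + 1.
  by move=> xC; rewrite (le_trans xC)// lerDl.
(* The bound 1 serves the Gronwall loop, the other pays for returning from the sup norm to
   [enorm]. *)
pose h' := Num.min 1 (h / n.+1%:R).
have h'0 : 0 < h' by rewrite lt_min ltr01 divr_gt0.
have h'1 : h' <= 1 by rewrite ge_min lexx.
have h'h : n.+1%:R * h' <= h.
  by rewrite mulrC -ler_pdivlMr ?ltr0n// ge_min lexx orbT.
have M1 : 0 < M + 1 by rewrite ltr_wpDl.
have [s [eta [eta0 sP]]] := @uniform_averaging R n fbar C L B (M + 1) h'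
  L0 B0 M1 h'0 h'1
  (fun x y xC yC => fbar_lipschitz _ _ LP x y (C1 _ xC) (C1 _ yC))
  (fun x xC => fbar_bounded _ _ BP x (C1 _ xC)).
exists s, eta; split=> // j; have [e1 e10 H] := sP j.
exists e1 => // w wg eps x e0 ee1 ee0 xr t /andP[t0 tM].
(* The step from index [k] reads the noise at [k.+1], the same shift as in [settled]. *)
have /(_ (fun k x => f x (Y k.+1 w))) {}H := H.
have te : 0 <= t / eps by rewrite divr_ge0// ltW.
have kt : eps * (Num.truncn (t / eps))%:R <= t.
  by rewrite mulrC -ler_pdivlMr// truncn_le.
have D : `|Xseq f Y eps x w (Num.truncn (t / eps)) -
          Xbar_d fbar eps x (Num.truncn (t / eps))| <= h'.
  apply: (H _ _ _ eps) => //.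
  - by move=> k y z yC zC; exact: LP.
  - by move=> k y yC; apply: BP => //; exact: C1.
  - by move=> k; exact: bounded_average.
  - by rewrite (le_trans kt)// (le_trans tM)// lerDl.
rewrite (le_trans (ler_enorm_sub _ (Xbar_d fbar eps x (Num.truncn (t / eps)))))//.
by rewrite lerD ?stable// (le_trans _ h'h)// ler_pM2l ?ltr0n.
Qed.

Lemma averaging : exists Tf, averaging_conclusion P f Y eps0 r c g Tf.
Proof.
(* One integer [M] governs the horizon, the tolerance and, below, the missing probability, so a
   single diagonal choice treats all three. *)
have /choice[sh /= shP] : forall M : nat, exists sh : seq 'rV[R]_n * R, 0 < sh.2 /\
  forall j, exists2 e1 : R, 0 < e1 &
  forall w, settled sh.1 sh.2 j w ->
  forall eps x, 0 < eps -> eps < e1 -> eps < eps0 -> enorm x < r eps ->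
  forall t, 0 <= t <= M%:R ->
    enorm (pc (Xseq f Y eps x w) eps t) <=
      c eps * enorm x * expR (- g eps * t) + M.+1%:R^-1.
  move=> M.
  have [|s [eta [eta0 H]]] := averaging_on_settled M%:R M.+1%:R^-1 (ler0n _ _).
    by rewrite invr_gt0 ltr0n.
  by exists (s, eta).
have /choice[je /= jeP] : forall M : nat, exists je : nat * R, 0 < je.2 /\
  (((1 - M.+1%:R^-1)%:E <= P (settled (sh M).1 (sh M).2 je.1))%E /\
  forall w, settled (sh M).1 (sh M).2 je.1 w ->
  forall eps x, 0 < eps -> eps < je.2 -> eps < eps0 -> enorm x < r eps ->
  forall t, 0 <= t <= M%:R ->
    enorm (pc (Xseq f Y eps x w) eps t) <=
      c eps * enorm x * expR (- g eps * t) + M.+1%:R^-1).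
  move=> M; have [eta0 H] := shP M.
  have [|j jP] := @probability_settled (sh M).1 (sh M).2 M.+1%:R^-1 eta0.
    by rewrite invr_gt0 ltr0n.
  by have [e1 e10 e1P] := H j; exists (j, e1).
have [Tf [Tfoo TfP]] := diagonal_horizon (fun M => (je M).2) (fun M => (jeP M).1).
have small (a : R) : 0 < a -> exists M : nat, M.+1%:R^-1 <= a.
  move=> a0; exists (Num.truncn a^-1).
  rewrite invf_ple ?posrE ?ltr0n// ltW//.
  by have := @truncn_itv R a^-1; rewrite invr_ge0 (ltW a0) => /(_ isT)/andP[].
exists Tf; split=> [M|x delta delta0].
  by have [e1 e10 H] := Tfoo M; exists e1 => // eps *; exact: H.
split.
  (* For the almost sure claim [delta] is fixed and only the horizon varies; integer horizons leave
     countably many null sets. *)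
  have /choice[sd /= sdP] : forall M : nat, exists sh : seq 'rV[R]_n * R, 0 < sh.2 /\
    forall j, exists2 e1 : R, 0 < e1 &
    forall w, settled sh.1 sh.2 j w ->
    forall eps x, 0 < eps -> eps < e1 -> eps < eps0 -> enorm x < r eps ->
    forall t, 0 <= t <= M%:R ->
      enorm (pc (Xseq f Y eps x w) eps t) <=
        c eps * enorm x * expR (- g eps * t) + delta.
    move=> M.
    have [s [eta [eta0 H]]] := averaging_on_settled M%:R delta (ler0n _ _) delta0.
    by exists (s, eta).
  have := ae_foralln (fun M => ae_cvg_seq (sd M).1).
  apply: filterS => w wM M.
  pose N := (Num.truncn `|M|).+1.
  have MN : M < N%:R.
    rewrite (le_lt_trans (ler_norm M))//.
    by have /andP[] := truncn_itv (normr_ge0 M).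
  have [sd0 H] := sdP N.
  have [j jw] := settled_of_cvg _ _ _ sd0 (wM N).
  have [e1 e10 {}H] := H j; exists e1 => // eps e0 ee1 ee0 xr.
  apply: le_ereal_inf_tmp => _ [t [t0 tP] <-]; rewrite lee_fin.
  rewrite leNgt; apply/negP => tM; move: tP.
  rewrite ltNge H// t0/= ltW//; exact: lt_trans tM MN.
move=> eta eta0.
have [M1 M1P] := small _ delta0; have [M2 M2P] := small _ eta0.
(* The 1 makes the horizon positive, as [TfP] requires; [M1] secures the tolerance [delta] and [M2]
   the probability [1 - eta]. *)
have [e1 e10 H] := Tfoo (maxn 1 (maxn M1 M2)).
exists e1 => // eps e0 ee1 ee0 xr; have {H} := H _ e0 ee1.
rewrite !geq_max => /and3P[T1 TM1 TM2].
have dec (M : nat) : (M <= Tf eps)%N -> (Tf eps).+1%:R^-1 <= M.+1%:R^-1 :> R.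
  by move=> MT; rewrite lef_pV2 ?posrE ?ltr0n// ler_nat.
have [_ [PG GP]] := jeP (Tf eps).
apply: (@le_trans _ _ (P (settled (sh (Tf eps)).1 (sh (Tf eps)).2 (je (Tf eps)).1))).
  by apply: le_trans PG; rewrite lee_fin lerD2l lerN2 (le_trans (dec _ TM2)).
apply: le_measure; rewrite ?inE.
- exact: measurable_settled.
- exact: measurable_event.
move=> w wG t tT /=.
rewrite (le_trans (GP w wG eps x e0 _ ee0 xr t tT))//; first exact: TfP.
by rewrite lerD2l (le_trans (dec _ TM1)).
Qed.

End Averaging.

(** * Choice of constants in the non-uniform and uniform cases *)

Theorem theorem6 (R : realType) (d : measure_display) (Omega : measurableType d)
  (P : probability Omega R) (n m : nat) (eps0 : R)
  (f : 'rV[R]_n -> 'rV[R]_m -> 'rV[R]_n) (Y : nat -> Omega -> 'rV[R]_m)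
  (S_Y : set 'rV[R]_m) (fbar : 'rV[R]_n -> 'rV[R]_n) :
  0 < eps0 ->
  (* complete probability space *)
  measure_is_complete P ->
  (* {Y_k} is a stochastic sequence with state space S_Y *)
  (forall k (i : 'I_m), measurable_fun setT (fun w => Y k w ord0 i)) ->
  (forall k w, S_Y (Y k w)) ->
  (* (A1) *)
  continuous (fun p : 'rV[R]_n * 'rV[R]_m => f p.1 p.2) ->
  (forall x, exists M : R, forall y, S_Y y -> enorm (f x y) <= M) ->
  (forall D : set 'rV[R]_n, compact D -> exists kD : R,
     forall x1 x2 y, D x1 -> D x2 -> S_Y y ->
       enorm (f x1 y - f x2 y) <= kD * enorm (x1 - x2)) ->
  (* (A2) ergodicity: time averages converge a.s. to fbar x *)
  (forall x, {ae P, forall w,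
     (fun N : nat => (N.+1%:R)^-1 *: \sum_(k < N.+1) f x (Y k.+1 w))
       @ \oo --> fbar x}) ->
  fbar 0 = 0 ->
  (* non-uniform exponential stability of Xbar_d for every eps *)
  ((forall eps, 0 < eps -> eps < eps0 ->
     exists r c g : R, [/\ 0 < r, 0 < c, 0 < g &
       forall x, enorm x < r -> forall t, 0 <= t ->
         enorm (pc (Xbar_d fbar eps x) eps t) <= c * enorm x * expR (- g * t)]) ->
   exists (r c g : R -> R) (Tf : R -> nat),
     (forall eps, 0 < eps -> eps < eps0 -> [/\ 0 < r eps, 0 < c eps & 0 < g eps]) /\
     averaging_conclusion P f Y eps0 r c g Tf)
  /\
  (* uniform exponential stability gives eps-independent constants *)
  ((exists r c g : R, [/\ 0 < r, 0 < c, 0 < g &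
       forall eps, 0 < eps -> eps < eps0 ->
       forall x, enorm x < r -> forall t, 0 <= t ->
         enorm (pc (Xbar_d fbar eps x) eps t) <= c * enorm x * expR (- g * t)]) ->
   exists (r c g : R) (Tf : R -> nat), [/\ 0 < r, 0 < c, 0 < g &
     averaging_conclusion P f Y eps0 (fun _ => r) (fun _ => c) (fun _ => g) Tf]).
Proof.
move=> _ _ mY YS fC fB fL fE _; split => [H|[r [c [g [r0 c0 g0 H]]]]]; last first.
  (* With uniform constants the average paths already stay in the ball of radius [c * r]. *)
  have [|||Tf TfP] := @averaging R d Omega P n m eps0 f Y S_Y fbar mY YS fC fB fL fE
    (fun=> r) (fun=> c) (fun=> g) (c * r).
  - by rewrite mulr_ge0 ?ltW.
  - by [].
  - exact: H.
  by exists r, c, g, Tf.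
have /choice[k kP] : forall eps, exists k : R * R * R, 0 < eps -> eps < eps0 ->
    [/\ 0 < k.1.1, 0 < k.1.2, 0 < k.2 &
      forall x, enorm x < k.1.1 -> forall t, 0 <= t ->
        enorm (pc (Xbar_d fbar eps x) eps t) <= k.1.2 * enorm x * expR (- k.2 * t)].
  move=> eps; have [[e0 e1]|ne] := pselect (0 < eps /\ eps < eps0).
    by have [r [c [g rcg]]] := H eps e0 e1; exists (r, c, g).
  (* Default values for [eps] outside the admissible interval. *)
  by exists (0, 0, 0) => e0 e1; exfalso; apply: ne.
(* Shrinking the radius confines the average system to the unit ball
   uniformly in [eps]. *)
have [|||Tf TfP] := @averaging R d Omega P n m eps0 f Y S_Y fbar mY YS fC fB fL fE
  (fun eps => Num.min (k eps).1.1 (k eps).1.2^-1)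
  (fun eps => (k eps).1.2) (fun eps => (k eps).2) 1.
- by [].
- move=> eps e0 e1; have [r0 c0 g0 _] := kP _ e0 e1; split => //.
  by rewrite mulrC -ler_pdivlMr// ge_min div1r lexx orbT.
- move=> eps e0 e1 x; have [_ _ _ st] := kP _ e0 e1.
  by rewrite lt_min => /andP[xr _]; exact: st.
exists (fun eps => Num.min (k eps).1.1 (k eps).1.2^-1),
  (fun eps => (k eps).1.2), (fun eps => (k eps).2), Tf; split => // eps e0 e1.
by have [r0 c0 g0 _] := kP _ e0 e1; split => //; rewrite lt_min r0 invr_gt0.
Qed.
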